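(* Let $c$ and $n$ be positive integers with $n\geq 2$. If $\mathcal{L}$ is a local realizer of $\mathcal{B}_n^1$ of size at most $cn$, then the frequency of $\mathcal{L}$ is at least $\dfrac{n}{2(c+1)}$.
   Context: A poset is a pair $P=(X,\leq)$ where $X$ is a non-empty set and $\leq$ is a reflexive, antisymmetric, transitive relation on $X$. A poset $Q$ is a subposet of $P$ if the ground set of $Q$ is a subset of that of $P$ and the order of $Q$ is the restriction of the order of $P$. A linear extension of $P$ is a linear order $L$ on the ground set of $P$ such that $x\leq_L y$ whenever $x\leq_P y$. A partial linear extension of $P$ is a linear extension of a subposet of $P$. A local realizer of $P$ is a family $\mathcal{L}$ of partial linear extensions of $P$ such that for all $x,y\in P$ there exists $L\in\mathcal{L}$ with $x,y\in L$, and $x\leq_P y$ if and only if there is no $L\in\mathcal{L}$ with $y<_L x$. The size of $\mathcal{L}$ is the number of its elements. The frequency of an element $x\in P$ in $\mathcal{L}$ is the number of $L\in\mathcal{L}$ with $x\in L$ (i.e. $x$ is in the ground set of $L$); the frequency of $\mathcal{L}$ is the maximum frequency of an element of $P$ in $\mathcal{L}$. For a positive integer $n$, $\mathcal{B}_n^1$ is the poset on all nonempty subsets of $[n]=\{1,\dots,n\}$ in which $A\leq B$ if and only if $A=B$, or $|A|=1$ and $A\subseteq B$. *)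

(* Defs.v *)
From HB Require Import structures.
From mathcomp Require Import all_boot all_order all_algebra.
Set Implicit Arguments.
Unset Strict Implicit.
Unset Printing Implicit Defensive.
Import Order.TTheory.
Local Open Scope order_scope.

Section LocalRealizer.
Context {disp : Order.disp_t} {P : finPOrderType disp}.

(* [ple_le] is supported on [ple_ground], so it is a relation on the ground
   set of the subposet, and not merely the restriction of one on [P]. *)
Record partial_linear_extension := PartialLinearExtension {
  ple_ground : {set P};
  ple_le : rel P;
  ple_ground_neq0 : ple_ground != set0;
  ple_leW : forall x y, ple_le x y -> x \in ple_ground /\ y \in ple_ground;
  ple_refl : {in ple_ground, reflexive ple_le};
  ple_anti : antisymmetric ple_le;
  ple_trans : transitive ple_le;
  ple_total : {in ple_ground &, total ple_le};
  ple_extends : {in ple_ground &, forall x y, x <= y -> ple_le x y}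
}.

Definition ple_lt (L : partial_linear_extension) (x y : P) : bool :=
  (x != y) && ple_le L x y.

(* A family may repeat a partial linear extension; repetitions are counted in
   the size [#|I|] and in the frequencies. *)
Context {I : finType}.
Implicit Type LL : I -> partial_linear_extension.

Definition local_realizer LL : Prop :=
  forall x y : P,
    (exists i, x \in ple_ground (LL i) /\ y \in ple_ground (LL i)) /\
    (x <= y <-> ~ exists i, ple_lt (LL i) y x).

Definition family_size LL : nat := #|I|.

Definition elt_frequency LL (x : P) : nat :=
  #|[set i | x \in ple_ground (LL i)]|.

Definition frequency LL : nat := \max_(x : P) elt_frequency LL x.

End LocalRealizer.

Arguments partial_linear_extension {disp} P.

(* The carrier of the poset B_n^1, with [n] rendered as 'I_n. *)
Definition B1 (n : nat) := {A : {set 'I_n} | A != set0}.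

HB.instance Definition _ (n : nat) := SubFinite.on (B1 n).

Section B1Order.
Variable n : nat.

Definition B1_le (A B : B1 n) : bool :=
  (A == B) || (#|val A| == 1%N) && (val A \subset val B).

Lemma B1_le_refl : reflexive B1_le.
Proof. by move=> A; rewrite /B1_le eqxx. Qed.

Lemma B1_le_anti : antisymmetric B1_le.
Proof.
move=> A B /andP[/predU1P[-> //|/andP[_ sAB]] /predU1P[-> //|/andP[_ sBA]]].
by apply/val_inj/eqP; rewrite eqEsubset sAB.
Qed.

Lemma B1_le_trans : transitive B1_le.
Proof.
move=> B A C /predU1P[-> //|/andP[cA sAB]] /predU1P[<-|/andP[_ sBC]].
  by rewrite /B1_le cA sAB orbT.
by rewrite /B1_le cA (subset_trans sAB sBC) orbT.
Qed.

End B1Order.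

Fact B1_display : Order.disp_t. Proof. exact: Order.Disp tt tt. Qed.

HB.instance Definition _ (n : nat) :=
  Order.Le_isPOrder.Build B1_display (B1 n)
    (@B1_le_refl n) (@B1_le_anti n) (@B1_le_trans n).

Lemma B1_leE n (A B : B1 n) :
  (A <= B) = (A == B) || (#|val A| == 1%N) && (val A \subset val B).
Proof. by []. Qed.

(* Main.v *)
Require Import Defs.
From HB Require Import structures.
From mathcomp Require Import all_boot all_order all_algebra.
From mathcomp Require Import zify.
Set Implicit Arguments.
Unset Strict Implicit.
Unset Printing Implicit Defensive.
Import Order.TTheory GRing.Theory Num.Theory.
Local Open Scope ring_scope.

(** Let [A] be a nonempty subset of [n] and [S] its complement. For each [x] in
    [S] the singleton [{x}] is not below [A], so some partial linear extension
    [L] of the realizer puts [A] strictly below [{x}]. In such an [L] the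
    singletons above [A] form an up-set [U] among the singletons of [L], and [U]
    contains no singleton [{a}] with [a] in [A], since [{a}] lies below [A].
    Hence, if [S] contains at most one of the two topmost singletons of every
    [L], each [L] containing [A] serves at most one [x] in [S], and the frequency
    of [A] is at least the cardinality of [S] ([uncovered_le_frequency]).

    It remains to find a large such [S]. Joining the two topmost singletons of
    each [L] by an edge gives a graph on [n] vertices with at most [c * n] edges,
    and by Turan's theorem it has an independent set with at least
    [n / (2 * c + 1)] elements ([independent_transversal]). This is slightly more
    than what is required. The set [A] is nonempty because two distinct
    singletons meet in some [L], so that the graph has an edge. *)

(** * Independent sets in sparse graphs *)

Section Turan.
Variables (X : finType) (e : rel X).

Definition nbhd (V : {set X}) x := [set y in V | e x y].

(** Turan's bound [#|V| / (d + 1)], with [d] the average degree, made linear: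
    solved for [#|S|], the inequality replaces this convex function of [d] by
    the line that agrees with it at [d = t - 1] and [d = t]. A vertex of minimum
    degree goes into the independent set and its closed neighbourhood is deleted.
    With minimum degree [k] this removes [k.+1] vertices and lowers the degree
    sum by at least [k * k.+1], and [2 * t * k.+1 - k * k.+1 <= t * t.+1]. *)
Lemma turan_linear (t : nat) (V : {set X}) : symmetric e -> irreflexive e ->
  exists S : {set X}, [/\ S \subset V, {in S &, forall x y, ~~ e x y} &
    (2 * t * #|V| <= t * t.+1 * #|S| + \sum_(x in V) #|nbhd V x|)%N].
Proof.
move=> e_sym e_irr; have [m] := ubnP #|V|; elim: m V => // m IHm V ltVm.
have [->|[v0 Vv0]] := set_0Vmem V.
  by exists set0; split=> [||]; rewrite ?sub0set ?cards0 ?muln0 // => x y; rewrite inE.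
case: (arg_minnP (fun x => #|nbhd V x|) Vv0) => v Vv min_v.
pose N := v |: nbhd V v; pose k := #|nbhd V v|.
have cN : #|N| = k.+1 by rewrite cardsU1 inE e_irr andbF.
have sNV : N \subset V.
  by apply/subsetP=> y; rewrite !inE => /predU1P[-> //|/andP[]].
have cV : #|V| = (k.+1 + #|V :\: N|)%N.
  by rewrite -(cardsID N V) (setIidPr sNV) cN.
have [|S [sSV indS boundS]] := IHm (V :\: N); first by lia.
have notNS y : y \in S -> [/\ y \in V, y != v & ~~ e v y].
  move/(subsetP sSV); rewrite !inE negb_or negb_and => /andP[/andP[-> /orP[/negP//|->]] yV].
  by rewrite yV.
exists (v |: S); split.
- apply/subsetP=> y; rewrite !inE => /predU1P[-> //|/notNS[]//].
- move=> x y; rewrite !inE.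
  case/predU1P=> [->|xS] /predU1P[->|yS]; rewrite ?e_irr //.
  + by have [] := notNS y yS.
  + by rewrite e_sym; have [] := notNS x xS.
  + exact: indS.
have vS : v \notin S by apply/negP=> /notNS[_]; rewrite eqxx.
rewrite cardsU1 vS (big_setID N) /= (setIidPr sNV).
have degN : (k * k.+1 <= \sum_(x in N) #|nbhd V x|)%N.
  rewrite -cN mulnC -sum_nat_const; apply: leq_sum => x xN.
  by apply: min_v; apply: (subsetP sNV).
have degD : (\sum_(x in V :\: N) #|nbhd (V :\: N) x|
             <= \sum_(x in V :\: N) #|nbhd V x|)%N.
  apply: leq_sum => x _; apply/subset_leq_card/subsetP => y.
  by rewrite !inE => /andP[/andP[_ ->] ->].
(* The difference of the two sides is [(t - k) * (t - k - 1)], a product of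
   consecutive integers. *)
have tk : (2 * t * k.+1 <= t * t.+1 + k * k.+1)%N.
  by have [/subnK <-|/ltnW/subnK <-] := leqP k t; nia.
by rewrite cV; nia.
Qed.

End Turan.

Lemma card_le_sum_cover (X I : finType) (P : pred I) (F : I -> {set X})
    (S : {set X}) :
  (forall x, x \in S -> exists2 i, P i & x \in F i) ->
  (#|S| <= \sum_(i | P i) #|F i|)%N.
Proof.
move=> coverS; apply: (@leq_trans #|\bigcup_(i | P i) F i|).
  by apply/subset_leq_card/subsetP=> x /coverS[i Pi Fx]; apply/bigcupP; exists i.
elim/big_rec2: _ => [|i m U _ leUm]; first by rewrite cards0.
by apply: leq_trans (leq_card_setU _ _) _; rewrite leq_add2l.
Qed.

(** The sets [T i] with two elements are the edges of a graph of average degree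
    at most [2 * c], and with [t = 2 * c + 1] the line of [turan_linear]
    loses nothing at that degree. *)
Lemma independent_transversal (X I : finType) (T : I -> {set X}) (c : nat) :
    (forall i, (#|T i| <= 2)%N) -> (#|I| <= c * #|X|)%N ->
  exists S : {set X},
    (forall i, (#|S :&: T i| <= 1)%N) /\ (#|X| <= (2 * c + 1) * #|S|)%N.
Proof.
move=> T2 leI.
pose e x y := (x != y) && [exists i, (x \in T i) && (y \in T i)].
have e_sym : symmetric e.
  by move=> x y; rewrite /e eq_sym; under eq_existsb do rewrite andbC.
have e_irr : irreflexive e by move=> x; rewrite /e eqxx.
have [S [_ indS boundS]] := turan_linear (2 * c + 1) setT e_sym e_irr.
exists S; split=> [i|].
  rewrite leqNgt; apply/negP => /card_gt1P[x [y []]].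
  rewrite !inE => /andP[xS xT] /andP[yS yT] neq_xy.
  by case/negP: (indS x y xS yS); rewrite /e neq_xy; apply/existsP; exists i; rewrite xT.
have degT : (\sum_(x in [set: X]) #|nbhd e setT x| <= 2 * #|I|)%N.
  have -> : (2 * #|I| = \sum_(i : I) 2)%N by rewrite sum_nat_const mulnC.
  apply: (@leq_trans (\sum_i \sum_(x in T i) #|T i :\ x|)); last first.
    apply: leq_sum => i _; apply: (@leq_trans (\sum_(x in T i) 1)%N).
      by apply: leq_sum => x xT; have := T2 i; rewrite (cardsD1 x) xT.
    by rewrite sum1_card.
  rewrite (exchange_big_dep xpredT) //= [leqLHS]big_mkcond /=; apply: leq_sum => x _.
  rewrite inE; apply: card_le_sum_cover => y.
  rewrite !inE /= => /andP[neq_xy] /existsP[i /andP[xT yT]].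
  by exists i; rewrite // !inE eq_sym neq_xy.
rewrite cardsT in boundS; nia.
Qed.

(** * Up-sets of a total preorder *)

Section TopTwo.
Variables (X : finType) (r : rel X).
Hypothesis r_trans : transitive r.

(** An element whose down-set in [G] has the most elements is a top element: by
    totality, an element not below it would have a strictly larger down-set. *)
Lemma ex_top (G : {set X}) : {in G &, total r} -> G != set0 ->
  exists2 m, m \in G & {in G, forall y, r y m}.
Proof.
move=> r_total /set0Pn[x0 Gx0].
case: (arg_maxnP (fun x => #|[set y in G | r y x]|) Gx0) => m Gm max_m.
exists m => // y Gy; apply: contraT => nle_ym.
have le_my : r m y by case/orP: (r_total _ _ Gy Gm) => // le_ym; rewrite le_ym in nle_ym.
have /= := max_m y Gy; rewrite leqNgt => /negP[]; apply: proper_card.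
apply/properP; split.
  by apply/subsetP=> z; rewrite !inE => /andP[-> /r_trans->].
exists y; rewrite !inE Gy ?(negPf nle_ym) //=.
by case/orP: (r_total _ _ Gy Gy).
Qed.

(** The property by which the two topmost elements are used; phrasing it with
    up-sets covers the degenerate case of a ground set [G] with at most one
    element, where [T] may be empty. *)
Definition top_two (G T : {set X}) :=
  forall U : {set X}, U \subset G ->
    {in U & G, forall x y, r x y -> y \in U} ->
    (1 < #|U|)%N -> (1 < #|U :&: T|)%N.

Lemma ex_top_two (G : {set X}) : {in G &, total r} ->
  exists T : {set X}, (#|T| <= 2)%N /\ top_two G T.
Proof.
move=> r_total; have [cG|cG] := leqP #|G| 1.
  exists set0; rewrite cards0; split=> // U sUG _ cU.
  by have := leq_trans cU (leq_trans (subset_leq_card sUG) cG).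
have [|m Gm top_m] := ex_top r_total.
  by rewrite -card_gt0 ltnW.
have [||m' Gm' top_m'] := @ex_top (G :\ m).
- by move=> x y /setD1P[_ Gx] /setD1P[_ Gy]; apply: r_total.
- by rewrite -card_gt0; move: cG; rewrite (cardsD1 m) Gm.
case/setD1P: Gm' => neq_m'm Gm'.
exists [set m; m']; split=> [|U sUG upU /card_gt1P[x [y [Ux Uy neq_xy]]]].
  by rewrite cards2; case: (_ != _).
have Um : m \in U by apply: (upU x) => //; apply/top_m/(subsetP sUG).
have Um' : m' \in U.
  have [z Uz neq_zm] : exists2 z, z \in U & z != m.
    by have [<-|] := eqVneq x m; [exists y; rewrite // eq_sym | exists x].
  by apply: (upU z) => //; apply: top_m'; rewrite !inE neq_zm (subsetP sUG).
by apply/card_gt1P; exists m', m; rewrite !inE !eqxx orbT Um Um'.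
Qed.

End TopTwo.

(** * Realizers of the poset of nonempty subsets *)

Definition singleton n (x : 'I_n) : B1 n :=
  Sub [set x] (introT (set0Pn _) (ex_intro _ x (set11 x))).

Section Realizer.
Variables (n : nat) (I : finType) (LL : I -> partial_linear_extension (B1 n)).
Hypothesis LL_realizer : local_realizer LL.

Definition singletons_in (i : I) : {set 'I_n} :=
  [set x | singleton x \in ple_ground (LL i)].

Definition singleton_le (i : I) : rel 'I_n :=
  [rel x y | ple_le (LL i) (singleton x) (singleton y)].

Lemma singleton_le_trans i : transitive (singleton_le i).
Proof. by move=> y x z; apply: ple_trans. Qed.

Lemma singleton_le_total i : {in singletons_in i &, total (singleton_le i)}.
Proof. by move=> x y; rewrite !inE; apply: ple_total. Qed.

Lemma ple_lt_separates (A : B1 n) x : x \notin val A ->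
  exists i, ple_lt (LL i) A (singleton x).
Proof.
move=> xA; apply/existsP; apply: contraT => /existsPn noL.
have [_ [_ leAx]] := LL_realizer (singleton x) A.
have : (singleton x <= A)%O by apply: leAx => -[i]; apply/negP/noL.
rewrite B1_leE cards1 sub1set (negPf xA) andbF orbF => /eqP eqA.
by rewrite -eqA set11 in xA.
Qed.

Definition singletons_above (A : B1 n) (i : I) : {set 'I_n} :=
  [set x | ple_lt (LL i) A (singleton x)].

Lemma singletons_above_sub A i : singletons_above A i \subset singletons_in i.
Proof. by apply/subsetP=> x; rewrite !inE => /andP[_ /ple_leW[]]. Qed.

(** An extension cannot reverse the comparability of [{x}] with a set [A] that
    contains [x]. *)
Lemma singletons_above_notin A i x : x \in singletons_above A i -> x \notin val A.
Proof.
rewrite inE => /andP[neq leAx]; have [gA gx] := ple_leW leAx.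
apply: contra neq => xA; apply/eqP/(@ple_anti _ _ (LL i)).
by rewrite leAx; apply: ple_extends => //; rewrite B1_leE cards1 sub1set xA orbT.
Qed.

Lemma singletons_above_up A i :
  {in singletons_above A i & singletons_in i,
    forall x y, singleton_le i x y -> y \in singletons_above A i}.
Proof.
move=> x y; rewrite !inE => /andP[neq leAx] gy lexy.
rewrite /ple_lt (ple_trans leAx lexy) andbT; apply: contra neq => /eqP eqA.
by apply/eqP/(@ple_anti _ _ (LL i)); rewrite leAx eqA.
Qed.

(** Every [x] outside [A] is above [A] in some extension containing [A], so it
    suffices that each extension has at most one singleton above [A]. Two of
    them would make the up-set of singletons above [A] contain the top two
    singletons, although that up-set avoids [A]. *)
Lemma uncovered_le_frequency (T : I -> {set 'I_n}) (A : B1 n) :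
    (forall i, top_two (singleton_le i) (singletons_in i) (T i)) ->
    (forall i, (#|~: val A :&: T i| <= 1)%N) ->
  (#|~: val A| <= elt_frequency LL A)%N.
Proof.
move=> topT indA; rewrite /elt_frequency -sum1dep_card.
have above1 i : (#|singletons_above A i| <= 1)%N.
  rewrite leqNgt; apply/negP.
  move/(topT i _ (singletons_above_sub A i) (@singletons_above_up A i)).
  apply/negP; rewrite -leqNgt; apply: leq_trans (indA i).
  apply/subset_leq_card/setSI/subsetP => x /singletons_above_notin.
  by rewrite inE.
apply: (@leq_trans (\sum_(i | A \in ple_ground (LL i)) #|singletons_above A i|));
  last by apply: leq_sum.
apply: card_le_sum_cover => x; rewrite inE => /ple_lt_separates[i ltAx].
by exists i; [have /andP[_ /ple_leW[]] := ltAx | rewrite inE].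
Qed.

End Realizer.

Theorem theorem4 (c n : nat) (c_gt0 : (0 < c)%N) (n_ge2 : (2 <= n)%N)
    (I : finType) (LL : I -> partial_linear_extension (B1 n))
    (LL_realizer : local_realizer LL)
    (LL_size : (family_size LL <= c * n)%N) :
  n%:R / (2 * (c%:R + 1)) <= (frequency LL)%:R :> rat.
Proof.
have [T /all_and2[T2 topT]] := fin_all_exists (fun i =>
  ex_top_two (@singleton_le_trans _ _ LL i) (@singleton_le_total _ _ LL i)).
have [|S [indS boundS]] := independent_transversal (c := c) T2.
  by rewrite card_ord.
(* The singletons of 0 and 1 meet in some extension, whose top two singletons
   cannot both lie in [S]. *)
have nS0 : ~: S != set0.
  apply/eqP => /(congr1 (@setC _)); rewrite setCK setC0 => ST.
  pose x0 := Ordinal (ltnW n_ge2); pose x1 := Ordinal n_ge2.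
  have [[i [g0 g1]] _] := LL_realizer (singleton x0) (singleton x1).
  have := indS i; rewrite ST setTI leqNgt => /negP[].
  have : (1 < #|singletons_in LL i :&: T i|)%N.
    by apply: topT => //; apply/card_gt1P; exists x0, x1; rewrite !inE.
  by move/leq_trans; apply; rewrite subset_leq_card ?subsetIr.
pose A : B1 n := Sub (~: S) nS0.
have leSf : (#|S| <= frequency LL)%N.
  apply: leq_trans (leq_bigmax A).
  have := @uncovered_le_frequency _ _ _ LL_realizer T A topT.
  by rewrite /= setCK; apply.
rewrite ler_pdivrMr; last by rewrite -(natrD _ c 1) -natrM ltr0n; lia.
rewrite -(natrD _ c 1) -!natrM ler_nat.
by rewrite card_ord in boundS; apply: leq_trans boundS _; nia.
Qed.
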